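(* For all integers $s\ge 2$ and $m\ge 3$, the graph $K_{1,s}\times P_{2m+1}$ is antimagic.
   Context: $K_{1,s}$ denotes the star with one center and $s$ leaves, and $P_n$ denotes the path on $n$ vertices. For graphs $G$ and $H$, the direct product $G\times H$ has vertex set $V(G)\times V(H)$, with $(x,y)$ adjacent to $(x',y')$ if and only if $xx'\in E(G)$ and $yy'\in E(H)$. A (possibly disconnected) graph $G$ is antimagic if there is a bijection $f:E(G)\to\{1,2,\dots,|E(G)|\}$ such that the vertex sums $\sum_{e\ni v} f(e)$ are pairwise distinct over all vertices $v$ of $G$. *)

(* Defs.v *)
From mathcomp Require Import all_boot.

Set Implicit Arguments.
Unset Strict Implicit.
Unset Printing Implicit Defensive.

Record sgraph := SGraph {
  vertex :> finType;
  adj : rel vertex;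
  adj_sym : symmetric adj;
  adj_irrefl : irreflexive adj
}.

Definition edges (G : sgraph) : {set {set G}} :=
  [set e : {set G} | [exists x : G, exists y : G, adj x y && (e == [set x; y])]].

(* [None] is the center, [Some i] the leaves. *)
Definition star_adj (s : nat) : rel (option 'I_s) :=
  fun x y => (x == None) != (y == None).

Lemma star_adj_sym s : symmetric (@star_adj s).
Proof. by move=> x y; rewrite /star_adj eq_sym. Qed.

Lemma star_adj_irrefl s : irreflexive (@star_adj s).
Proof. by move=> x; rewrite /star_adj eqxx. Qed.

Definition star (s : nat) : sgraph :=
  SGraph (@star_adj_sym s) (@star_adj_irrefl s).

Definition path_adj (n : nat) : rel 'I_n :=
  fun i j => (i.+1 == j :> nat) || (j.+1 == i :> nat).

Lemma path_adj_sym n : symmetric (@path_adj n).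
Proof. by move=> i j; rewrite /path_adj orbC. Qed.

Lemma path_adj_irrefl n : irreflexive (@path_adj n).
Proof. by move=> i; rewrite /path_adj orbb gtn_eqF. Qed.

Definition path_graph (n : nat) : sgraph :=
  SGraph (@path_adj_sym n) (@path_adj_irrefl n).

Definition direct_adj (G H : sgraph) : rel (G * H)%type :=
  fun u v => adj u.1 v.1 && adj u.2 v.2.

Lemma direct_adj_sym G H : symmetric (@direct_adj G H).
Proof. by move=> u v; rewrite /direct_adj adj_sym [X in _ && X]adj_sym. Qed.

Lemma direct_adj_irrefl G H : irreflexive (@direct_adj G H).
Proof. by move=> u; rewrite /direct_adj adj_irrefl. Qed.

Definition direct_product (G H : sgraph) : sgraph :=
  SGraph (@direct_adj_sym G H) (@direct_adj_irrefl G H).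

Definition vertex_sum (G : sgraph) (f : {set G} -> nat) (v : G) : nat :=
  \sum_(e in edges G | v \in e) f e.

(* Only the values of [f] on [edges G] matter. *)
Definition edge_labeling (G : sgraph) (f : {set G} -> nat) : Prop :=
  [/\ {in edges G, forall e, 1 <= f e <= #|edges G|},
      {in edges G &, injective f}
    & forall k, 1 <= k <= #|edges G| -> exists2 e, e \in edges G & f e = k].

Definition antimagic (G : sgraph) : Prop :=
  exists f : {set G} -> nat, edge_labeling f /\ injective (vertex_sum f).

(* Main.v *)
Require Import Defs.
From mathcomp Require Import all_boot zify.

Set Implicit Arguments.
Unset Strict Implicit.
Unset Printing Implicit Defensive.

(** The labels [1 .. 4ms] are split into the consecutive pairs [2x+1, 2x+2], and
    [s] consecutive pairs form a block.  The two edges at a leaf vertex of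
    degree 2 receive one pair, so the sums of these vertices are the distinct
    numbers [4x+3]; the [2s] pendant edges share block [0], so pendant sums are
    too small to interfere.  Blocks increase along each of the two components,
    so the sums at the centers are governed by the blocks on either side, up to
    a correction of at most [2s].  What remains free is which label of a pair
    goes to which center.  It is chosen so that a center sum that is not above
    every leaf sum is never [3] modulo [4], and so that the corrections separate
    the centers whose neighbouring blocks have the same total. *)

(** * From symmetric weights on pairs of vertices to antimagic labelings *)

Lemma set2_eq (T : finType) (x y x' y' : T) :
  [set x; y] = [set x'; y'] -> (x = x' /\ y = y') \/ (x = y' /\ y = x').
Proof.
move=> E.
have /set2P Hx : x \in [set x'; y'] by rewrite -E set21.
have /set2P Hy : y \in [set x'; y'] by rewrite -E set22.
have /set2P Hx' : x' \in [set x; y] by rewrite E set21.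
have /set2P Hy' : y' \in [set x; y] by rewrite E set22.
by intuition congruence.
Qed.

Section EdgeWeights.

Variables (G : sgraph) (w : G -> G -> nat).
Hypothesis w_sym : forall x y, w x y = w y x.

(** An edge is an unordered pair, so [w] is read off an arbitrary ordering of it; symmetry makes the
    choice immaterial. Sets of any other form get the default 0. *)
Definition edge_weight (e : {set G}) : nat :=
  if [pick p : G * G | e == [set p.1; p.2]] is Some p then w p.1 p.2 else 0.

Lemma edge_weightE x y : edge_weight [set x; y] = w x y.
Proof.
rewrite /edge_weight; case: pickP => [p /eqP/set2_eq[] [-> ->] // |].
by move/(_ (x, y)); rewrite eqxx.
Qed.

Lemma edgeP (e : {set G}) :
  reflect (exists x y, adj x y /\ e = [set x; y]) (e \in edges G).
Proof.
rewrite inE; apply: (iffP existsP) => [[x /existsP[y /andP[xy /eqP->]]]|].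
  by exists x, y.
by move=> [x [y [xy ->]]]; exists x; apply/existsP; exists y; rewrite xy eqxx.
Qed.

Lemma vertex_sum_edge_weight v :
  vertex_sum edge_weight v = \sum_(u | adj v u) w v u.
Proof.
rewrite /vertex_sum.
rewrite (eq_bigl (mem [set [set v; u] | u in [pred u | adj v u]])); last first.
  move=> e; apply/andP/imsetP => [[/edgeP[x [y [xy ->]]]]|[u /= vu ->]].
    rewrite !inE => /orP[]/eqP->; first by exists y.
    by exists x; rewrite 1?setUC // inE adj_sym.
  by split; [apply/edgeP; exists v, u | rewrite !inE eqxx].
rewrite big_imset /=; last first.
  move=> u u' /= vu vu' /set2_eq[[_ //]|[vE uE]].
  by rewrite -vE in uE *.
by apply: eq_bigr => u _; rewrite edge_weightE.
Qed.

(** The number of edges comes for free: weights that hit each of [1 .. N] on exactly one edge force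
    it to be [N]. *)
Lemma antimagic_edge_weight N :
  (forall x y, adj x y -> 1 <= w x y <= N) ->
  (forall x y x' y', adj x y -> adj x' y' -> w x y = w x' y' ->
     [set x; y] = [set x'; y']) ->
  (forall k, 1 <= k <= N -> exists x y, adj x y /\ w x y = k) ->
  injective (fun v => \sum_(u | adj v u) w v u) -> antimagic G.
Proof.
move=> wN w_inj w_surj sum_inj.
have f_inj : {in edges G &, injective edge_weight}.
  move=> _ _ /edgeP[x [y [xy ->]]] /edgeP[x' [y' [xy' ->]]].
  by rewrite !edge_weightE; apply: w_inj.
have cardE : #|edges G| = N.
  have -> : #|edges G| = size (iota 1 N).
    rewrite cardE -(size_map edge_weight); apply: perm_size.
    apply: uniq_perm; last 1 first.
    - move=> k; rewrite mem_iota add1n ltnS; apply/mapP/idP => [[e]|kN].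
        rewrite mem_enum => /edgeP[x [y [xy ->]]] ->.
        by rewrite edge_weightE wN.
      have [x [y [xy <-]]] := w_surj k kN.
      exists [set x; y]; rewrite ?edge_weightE // mem_enum.
      by apply/edgeP; exists x, y.
    - rewrite map_inj_in_uniq ?enum_uniq // => e e'.
      by rewrite !mem_enum; apply: f_inj.
    - exact: iota_uniq.
  by rewrite size_iota.
exists edge_weight; split; last first.
  by move=> u v; rewrite !vertex_sum_edge_weight => /sum_inj.
split=> // [e /edgeP[x [y [xy ->]]]|k].
  by rewrite edge_weightE cardE wN.
rewrite cardE => /w_surj[x [y [xy <-]]].
by exists [set x; y]; rewrite ?edge_weightE //; apply/edgeP; exists x, y.
Qed.

End EdgeWeights.

(** * Sums over the neighbours in a path *)

Lemma sum_path_neighbours n (j : 'I_n) (F : nat -> nat) :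
  \sum_(l : 'I_n | path_adj j l) F l =
    (if 0 < j then F j.-1 else 0) + (if j.+1 < n then F j.+1 else 0).
Proof.
(* At most one position has value [a], so each side of [j] contributes a single term or, past an end
   of the path, none. *)
pose P a := \sum_(l : 'I_n | l == a :> nat) F l.
have PE a : P a = if a < n then F a else 0.
  rewrite /P; case: ltnP => an; first by rewrite (big_pred1 (Ordinal an)).
  by rewrite big_pred0 // => l; apply/eqP; move: (ltn_ord l); lia.
rewrite (bigID (fun l : 'I_n => l < j)) /=; congr (_ + _); last first.
  rewrite -PE; apply: eq_bigl => l; rewrite /path_adj; lia.
have [j0|j0] := ltnP; last by rewrite big_pred0 // => l; rewrite /path_adj; lia.
have <- : P j.-1 = F j.-1 by rewrite PE ifT //; move: (ltn_ord j); lia.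
by apply: eq_bigl => l; rewrite /path_adj; lia.
Qed.

(** * The labeling and its bijectivity onto [1 .. 4ms] *)

(* Blocks [0 .. m-1] serve the leaves at even positions, blocks [m .. 2m-1] those
   at odd positions; the pendant positions [0] and [2m] share block [0]. *)
Definition leaf_block m l :=
  if odd l then m + l./2 else if l == 2 * m then 0 else l./2.

(* Whether the edge from the center at [j] to the leaf [i] at [l] gets the
   larger label of its pair.  Around an odd center the choice is uniform and
   alternates with the center, which makes its sum even (except at
   [j = 2m - 1] with [s] and [m] odd).  For even [m] two pendant pairs are
   swapped: otherwise, when [4] divides [m], the centers at [m - 1] and
   [2m - 1] would have equal sums. *)
Definition upper m i j l : bool :=
  if odd l then j < l
  else if l == 0 then (i < 2) && ~~ odd m
  else if l == 2 * m then ~~ ((i < 2) && ~~ odd m)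
  else odd j./2.

Definition label s m i j l := (2 * (s * leaf_block m l + i) + upper m i j l).+1.

Definition weight s m (x y : option 'I_s * 'I_(2 * m + 1)) : nat :=
  match x.1, y.1 with
  | None, Some i => label s m i x.2 y.2
  | Some i, None => label s m i y.2 x.2
  | _, _ => 0
  end.

Lemma weight_sym s m (x y : option 'I_s * 'I_(2 * m + 1)) :
  weight x y = weight y x.
Proof. by case: x y => [[i|] j] [[k|] l]. Qed.

Lemma leaf_block_lt m l : 0 < m -> l < 2 * m + 1 -> leaf_block m l < 2 * m.
Proof. rewrite /leaf_block; do 2?case: ifP; lia. Qed.

Lemma label_bounds s m i j l : 0 < m -> i < s -> l < 2 * m + 1 ->
  1 <= label s m i j l <= 4 * m * s.
Proof.
move=> m0 si lm; have := leaf_block_lt m0 lm; rewrite /label.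
by case: (upper _ _ _ _) => /= ?; nia.
Qed.

(** Division by [s] recovers [i] and the block. A nonzero block determines [l], and [upper] then
    tells its two neighbours apart; in block 0, [upper] tells the two ends of the path apart. *)
Lemma label_inj s m i j l i' j' l' :
  0 < m -> i < s -> i' < s -> l < 2 * m + 1 -> l' < 2 * m + 1 ->
  j < 2 * m + 1 -> j' < 2 * m + 1 ->
  (j.+1 == l) || (l.+1 == j) -> (j'.+1 == l') || (l'.+1 == j') ->
  label s m i j l = label s m i' j' l' -> [/\ i = i', j = j' & l = l'].
Proof.
move=> m0 si si' lm lm' jm jm' jl jl' E.
have [Eb Eu] : s * leaf_block m l + i = s * leaf_block m l' + i' /\
               upper m i j l = upper m i' j' l'.
  by move: E; rewrite /label; do 2!case: (upper _ _ _ _); lia.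
have Ei : i = i'.
  by move: (congr1 (modn^~ s) Eb); rewrite ![s * _]mulnC !modnMDl !modn_small.
subst i'.
have {}Eb : leaf_block m l = leaf_block m l' by nia.
move: Eb Eu; rewrite /leaf_block /upper.
case ol: (odd l); case ol': (odd l').
- by move=> Eb Eu; split=> //; lia.
- by case: ifP; lia.
- by case: ifP; lia.
case: (_ && _); do 4?[case: ifP]; split=> //; lia.
Qed.

Lemma label_surj s m k : 0 < m -> 1 <= k <= 4 * m * s ->
  exists i j l, [/\ i < s, j < 2 * m + 1, l < 2 * m + 1,
    (j.+1 == l) || (l.+1 == j) & label s m i j l = k].
Proof.
move=> m0 kN.
have s0 : 0 < s by nia.
pose b := k.-1./2 %/ s; pose i := k.-1./2 %% s; pose u := odd k.-1.
have is' : i < s by rewrite ltn_mod.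
have bm : b < 2 * m by rewrite /b ltn_divLR //; nia.
have kE : k = (2 * (s * b + i) + u).+1.
  by rewrite mulnC [s * b]mulnC -divn_eq /u; lia.
suff [j [l [jm lm jl bE uE]]] : exists j l, [/\ j < 2 * m + 1, l < 2 * m + 1,
    (j.+1 == l) || (l.+1 == j), leaf_block m l = b & upper m i j l = u].
  by exists i, j, l; split; rewrite // /label bE uE.
clearbody b i u; clear kE kN k; rewrite /leaf_block /upper.
have [mb|mb] := leqP m b.
  exists (if u then (b - m).*2 else (b - m).*2.+2), (b - m).*2.+1.
  by split; case: u; rewrite /=; do ?[case: ifP]; lia.
have [b0|b0] := posnP b.
  have [Ez|Ez] := eqVneq u ((i < 2) && ~~ odd m).
    by exists 1, 0; split=> //=; do ?case: ifP; lia.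
  exists (2 * m).-1, (2 * m); rewrite oddM eqxx /= b0; split=> //; try lia.
  rewrite ifN; last lia.
  by move: Ez; case: (u); case: (_ && _).
(* The centers [j] on either side of [b.*2] have [j./2] equal to [b] and [b - 1]; the one where this
   has parity [u] is taken. *)
exists (if u == odd b then b.*2.+1 else b.*2.-1), b.*2.
by split; case: (eqVneq u (odd b)) => ?; do ?[case: ifP]; lia.
Qed.

(** * Closed form of the center sums *)

Lemma sum_label s m j l :
  \sum_(i < s) label s m i j l =
    s * s * (2 * leaf_block m l).+1 + \sum_(i < s) upper m i j l.
Proof.
(* Separating the offset [c] from [s] allows induction on the number of terms; [n * n] is the sum of
   the first [n] odd numbers. *)
have E n c : \sum_(i < n) (2 * (c + i) + upper m i j l).+1 =
    2 * n * c + n * n + \sum_(i < n) upper m i j l.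
  by elim: n => [|n IHn]; rewrite ?big_ord0 // !big_ord_recr /= IHn;
    move: (\sum_(i < n) _) (nat_of_bool _) => S u; nia.
by rewrite E; nia.
Qed.

Lemma sum_upper_inner s m j l : l != 0 -> l != 2 * m ->
  \sum_(i < s) upper m i j l = s * (if odd l then j < l else odd j./2).
Proof.
move=> l0 lm; rewrite /upper (negPf l0) (negPf lm).
by rewrite sum_nat_const card_ord; case: odd.
Qed.

Lemma sum_ltn2 s (b : bool) : 2 <= s -> \sum_(i < s) ((i < 2) && b) = 2 * b.
Proof.
case: s => [|[|s]] // _; rewrite 2!big_ord_recl big1 /= => [|i _].
  by case: b.
by rewrite /bump /=; case: b.
Qed.

Lemma sum_upper_first s m j : 2 <= s ->
  \sum_(i < s) upper m i j 0 = 2 * ~~ odd m.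
Proof. by move=> s2; rewrite -(sum_ltn2 _ s2). Qed.

Lemma sum_upper_last s m j : 2 <= s -> 0 < m ->
  \sum_(i < s) upper m i j (2 * m) = s - 2 * ~~ odd m.
Proof.
move=> s2 m0; rewrite -(sum_ltn2 _ s2).
have -> : \sum_(i < s) upper m i j (2 * m) =
    \sum_(i < s) ~~ ((i < 2) && ~~ odd m).
  by apply: eq_bigr => i _; rewrite /upper oddM /= eqxx ifN //; lia.
have : \sum_(i < s) ~~ ((i < 2) && ~~ odd m) +
    \sum_(i < s) ((i < 2) && ~~ odd m) = s.
  rewrite -big_split /= -[RHS]card_ord -sum1_card; apply: eq_bigr => i _.
  by case: (_ && _).
lia.
Qed.

Lemma leaf_block_odd m l : odd l -> leaf_block m l = m + l./2.
Proof. by rewrite /leaf_block => ->. Qed.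

Lemma leaf_block_even m l : ~~ odd l -> l < 2 * m -> leaf_block m l = l./2.
Proof. by rewrite /leaf_block => /negPf-> /ltn_eqF->. Qed.

Lemma leaf_block_last m : leaf_block m (2 * m) = 0.
Proof. by rewrite /leaf_block oddM eqxx. Qed.

Definition center_sum s m j :=
  (if 0 < j then \sum_(i < s) label s m i j j.-1 else 0) +
  (if j.+1 < 2 * m + 1 then \sum_(i < s) label s m i j j.+1 else 0).

Definition leaf_sum s m i l :=
  (if 0 < l then label s m i l.-1 l else 0) +
  (if l.+1 < 2 * m + 1 then label s m i l.+1 l else 0).

(** The coefficient of [s * s]: the sum of [2b + 1] over the blocks [b] next to position [j]. *)
Definition center_quo m j :=
  if odd j then (if j == (2 * m).-1 then 2 * m else 4 * j./2.+1)
  else if j == 0 then (2 * m).+1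
  else if j == 2 * m then (4 * m).-1 else 4 * (m + j./2).

(** The number of edges at the center that carry the larger label of their pair. For [s = 2] it can
    reach [s * s], so it is not always a Euclidean remainder. *)
Definition center_rem s m j :=
  if odd j then
    (if j == 1 then 2 * ~~ odd m
     else if j == (2 * m).-1 then (if odd m then s else 2 * s - 2)
     else 2 * s * odd j./2)
  else if j == 2 * m then 0 else s.

Lemma center_sumE s m j : 2 <= s -> 3 <= m -> j < 2 * m + 1 ->
  center_sum s m j = s * s * center_quo m j + center_rem s m j.
Proof.
move=> s2 m3 jm; rewrite /center_sum !sum_label /center_quo /center_rem.
have [oj|ej] := boolP (odd j).
  have -> : 0 < j by lia.
  have -> : j.+1 < 2 * m + 1 by lia.
  have [->|j1] := eqVneq j 1.
    have -> : (1 == (2 * m).-1) = false by lia.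
    rewrite /= sum_upper_first // sum_upper_inner //; try lia.
    by rewrite !leaf_block_even //=; lia.
  have [->|jl] := eqVneq j (2 * m).-1.
    have -> : (2 * m).-1.+1 = 2 * m by lia.
    rewrite sum_upper_last ?sum_upper_inner //; try lia.
    rewrite leaf_block_last leaf_block_even; try lia.
    have -> : odd (2 * m).-1.-1 = false by lia.
    have -> : (2 * m).-1.-1./2 = m.-1 by lia.
    have -> : (2 * m).-1./2 = m.-1 by lia.
    have -> : odd m.-1 = ~~ odd m by lia.
    by case: (odd m); rewrite /=; nia.
  rewrite !sum_upper_inner; try lia.
  rewrite !leaf_block_even; try lia.
  have -> : j.+1./2 = j./2.+1 by lia.
  have -> : j.-1./2 = j./2 by lia.
  have -> : odd j.+1 = false by lia.
  have -> : odd j.-1 = false by lia.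
  by case: odd; nia.
have [->|j0] := eqVneq j 0.
  have -> : 1 < 2 * m + 1 by lia.
  have -> : (0 == 2 * m) = false by lia.
  by rewrite (@sum_upper_inner s m 0 1) ?(@leaf_block_odd m 1) //=; [nia|lia].
have -> : 0 < j by lia.
have [->|jl] := eqVneq j (2 * m).
  have -> : (2 * m).+1 < 2 * m + 1 = false by lia.
  rewrite sum_upper_inner ?leaf_block_odd; try lia.
  have -> : (2 * m).-1./2 = m.-1 by lia.
  have -> : odd (2 * m).-1 by lia.
  by rewrite ltnNge leq_pred; nia.
have -> : j.+1 < 2 * m + 1 by lia.
rewrite !sum_upper_inner; try lia.
rewrite !leaf_block_odd; try lia.
have -> : odd j.+1 by lia.
have -> : odd j.-1 by lia.
have -> : j.+1./2 = j./2 by lia.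
have -> : j.-1./2 = j./2.-1 by lia.
have -> : (j < j.-1) = false by lia.
rewrite ltnSn.
have : 0 < j./2 by lia.
by nia.
Qed.

(** * Closed form of the leaf sums *)

Lemma leaf_sum_inner s m i l : 0 < l < 2 * m ->
  leaf_sum s m i l = 4 * (s * leaf_block m l + i) + 3.
Proof.
move=> lm; rewrite /leaf_sum.
have -> : 0 < l by lia.
have -> : l.+1 < 2 * m + 1 by lia.
(* Exactly one of the two edges gets the larger label; for even [l] this is because [j./2] changes
   parity between [l - 1] and [l + 1]. *)
have up : upper m i l.-1 l + upper m i l.+1 l = 1.
  rewrite /upper; have [l0|_] := eqVneq l 0; first lia.
  have [lE|_] := eqVneq l (2 * m); first lia.
  by case ol: (odd l); lia.
by rewrite /label; move: up; lia.
Qed.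

Lemma leaf_sum_first s m i : 0 < m ->
  leaf_sum s m i 0 = (2 * i + ((i < 2) && ~~ odd m)).+1.
Proof.
move=> m0; rewrite /leaf_sum ltnn ifT; last lia.
by rewrite /label leaf_block_even ?muln_gt0 // muln0.
Qed.

Lemma leaf_sum_last s m i : 0 < m ->
  leaf_sum s m i (2 * m) = (2 * i + ~~ ((i < 2) && ~~ odd m)).+1.
Proof.
move=> m0; rewrite /leaf_sum.
have -> : 0 < 2 * m by lia.
have -> : (2 * m).+1 < 2 * m + 1 = false by lia.
rewrite /label leaf_block_last /upper oddM eqxx /=.
have -> : (2 * m == 0) = false by lia.
by rewrite muln0 addn0.
Qed.

(** * Distinctness of the vertex sums *)

Lemma leaf_sum_inj s m i l i' l' : 2 <= s -> 3 <= m -> i < s -> i' < s ->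
  l < 2 * m + 1 -> l' < 2 * m + 1 ->
  leaf_sum s m i l = leaf_sum s m i' l' -> i = i' /\ l = l'.
Proof.
move=> s2 m3 si si' lm lm'.
have pend k n : k < s -> (n == 0) || (n == 2 * m) -> leaf_sum s m k n <= 2 * s.
  move=> sk /orP[]/eqP->; rewrite ?leaf_sum_first ?leaf_sum_last; lia.
have deep k n : 0 < n < 2 * m -> 2 * s < leaf_sum s m k n.
  move=> nm; rewrite leaf_sum_inner //.
  have : 0 < leaf_block m n by rewrite /leaf_block; do 2?case: ifP; lia.
  by nia.
have [lin|lout] := boolP (0 < l < 2 * m); last first.
  have {}lout : (l == 0) || (l == 2 * m) by lia.
  have [lin'|lout'] := boolP (0 < l' < 2 * m).
    by have := pend i l si lout; have := deep i' l' lin'; lia.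
  have {}lout' : (l' == 0) || (l' == 2 * m) by lia.
  case/orP: lout => /eqP->; case/orP: lout' => /eqP->;
    rewrite ?leaf_sum_first ?leaf_sum_last; lia.
have [lin'|lout'] := boolP (0 < l' < 2 * m); last first.
  have {}lout' : (l' == 0) || (l' == 2 * m) by lia.
  by have := pend i' l' si' lout'; have := deep i l lin; lia.
rewrite !leaf_sum_inner // => E.
have {}E : s * leaf_block m l + i = s * leaf_block m l' + i' by lia.
have Ei : i = i'.
  by move: (congr1 (modn^~ s) E); rewrite ![s * _]mulnC !modnMDl !modn_small.
have : leaf_block m l = leaf_block m l' by nia.
by rewrite /leaf_block; do 4?case: ifP; lia.
Qed.

Lemma center_sum_inj s m j j' : 2 <= s -> 3 <= m ->
  j < 2 * m + 1 -> j' < 2 * m + 1 ->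
  center_sum s m j = center_sum s m j' -> j = j'.
Proof.
move=> s2 m3 jm jm'; rewrite !center_sumE //.
have : 2 * s <= s * s by nia.
move: (s * s) => q q2 E.
have rem_le k : center_rem s m k <= q.
  rewrite /center_rem; do ?case: ifP; lia.
(* Remainders lie in [0 .. q], so the quotients agree or differ by one, the latter only with the
   extreme remainders [0] and [q]. *)
have cases K r K' r' : r <= q -> r' <= q -> q * K + r = q * K' + r' ->
    (K = K' /\ r = r') \/ (K = K'.+1 /\ r = 0 /\ r' = q) \/
    (K' = K.+1 /\ r' = 0 /\ r = q).
  move=> rq rq' EK; have [lt|gt|eq] := ltngtP K K'.
  - by right; right; have : K' = K.+1 by [nia]; move=> ?; subst K'; nia.
  - by right; left; have : K = K'.+1 by [nia]; move=> ?; subst K; nia.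
  - by left; split=> //; rewrite eq in EK; lia.
have {cases rem_le E} := cases _ _ _ _ (rem_le j) (rem_le j') E.
(* Distinct centers share a quotient only for even [m], at [m - 1] and [2m - 1], with remainders in
   [{0, 2s}] and [2s - 2]. Consecutive quotients always involve [j = 0], whose remainder [s] is
   neither [0] nor [q]. *)
rewrite /center_quo /center_rem.
case oj: (odd j); case oj': (odd j'); do ?[case: eqP => ?].
all: try lia.
all: by case: (odd m) => /=; case: (odd j./2); case: (odd j'./2); lia.
Qed.

Lemma center_sum_neq_leaf_sum s m i j l : 2 <= s -> 3 <= m ->
  i < s -> j < 2 * m + 1 -> l < 2 * m + 1 ->
  center_sum s m j <> leaf_sum s m i l.
Proof.
move=> s2 m3 si jm lm; rewrite center_sumE //.
(* This puts every center sum above [2s], hence above all pendant sums. *)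
have quo4 : 4 <= center_quo m j.
  by rewrite /center_quo; do ?case: ifP; lia.
have [lin|lout] := boolP (0 < l < 2 * m); last first.
  have {}lout : (l == 0) || (l == 2 * m) by lia.
  have : leaf_sum s m i l <= 2 * s.
    by case/orP: lout => /eqP->; rewrite ?leaf_sum_first ?leaf_sum_last; lia.
  by nia.
rewrite leaf_sum_inner // => E.
have bm : leaf_block m l < 2 * m by apply: leaf_block_lt => //; lia.
have {bm} small : s * s * center_quo m j + center_rem s m j < 8 * m * s.
  by rewrite E; nia.
(* The only small odd center sum is at [j = 2m - 1] with [s = 3] and [m] odd,
   where [18m + 3] is [1] modulo [4]. *)
suff : ~~ odd (s * s * center_quo m j + center_rem s m j) \/
  (s = 3 /\ s * s * center_quo m j + center_rem s m j = 18 * m + 3 /\ odd m).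
  by rewrite E; lia.
move: small; rewrite /center_quo /center_rem {E}.
case: (odd j).
  have [->|jl] := eqVneq j (2 * m).-1.
    have -> : ((2 * m).-1 == 1) = false by lia.
    case om: (odd m) => small; last by left; rewrite oddD !oddM oddB ?oddM //; lia.
    have : s < 4 by nia.
    case: s {i si} s2 small => [|[|[|[|s]]]] //= _ small _; first by left; lia.
    by right; lia.
  move=> _; left; rewrite oddD !oddM /= andbF /=.
  by case: ifP => _; rewrite ?oddM.
have [->|j0] := eqVneq j 0.
  have -> : (0 == 2 * m) = false by lia.
  (* The sum [s * s * (2m + 1) + s] has the parity of [s * s + s]. *)
  by move=> _; left; rewrite oddD !oddM /= oddM; case: odd.
(* An inner even [j] has quotient above [4m], so [s >= 2] would push its sum beyond [8ms]. *)
have [_|jl] := eqVneq j (2 * m) => small; last by nia.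
have : s < 3 by nia.
by case: s {i si} s2 small => [|[|[|s]]] //= *; left; lia.
Qed.

(** * Vertex sums in the direct product, and the conclusion *)

Lemma sum_option (T : finType) (F : option T -> nat) :
  \sum_x F x = F None + \sum_i F (Some i).
Proof.
rewrite (bigD1 None) //=; congr (_ + _).
rewrite (reindex_omap Some id) /=; last by case.
by apply: eq_bigl => i; rewrite eqxx.
Qed.

Lemma sum_direct_neighbours (G H : sgraph) (F : G * H -> nat)
    (v : direct_product G H) :
  \sum_(u | adj v u) F u =
  \sum_(x : G) (if adj v.1 x then \sum_(y | adj v.2 y) F (x, y) else 0).
Proof.
rewrite -big_mkcond /= pair_big_dep /=.
by apply: eq_big => [[x y]|[x y] _].
Qed.

Lemma sum_weight_center s m (j : 'I_(2 * m + 1)) :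
  \sum_(u | @adj (direct_product (star s) (path_graph (2 * m + 1))) (None, j) u)
    weight (None, j) u = center_sum s m j.
Proof.
rewrite sum_direct_neighbours sum_option /= add0n exchange_big /=.
exact: (sum_path_neighbours j (fun l => \sum_(i < s) label s m i j l)).
Qed.

Lemma sum_weight_leaf s m (i : 'I_s) (l : 'I_(2 * m + 1)) :
  \sum_(u | @adj (direct_product (star s) (path_graph (2 * m + 1))) (Some i, l) u)
    weight (Some i, l) u = leaf_sum s m i l.
Proof.
rewrite sum_direct_neighbours sum_option /= big1_eq addn0.
exact: (sum_path_neighbours l (fun j => label s m i j l)).
Qed.

Theorem theorem3p3 (s m : nat) (hs : 2 <= s) (hm : 3 <= m) :
  antimagic (direct_product (star s) (path_graph (2 * m + 1))).
Proof.
have m0 : 0 < m by lia.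
pose G := direct_product (star s) (path_graph (2 * m + 1)).
apply: (@antimagic_edge_weight G (@weight s m) (@weight_sym s m) (4 * m * s)).
- by move=> [[i|] j] [[k|] l] // _; apply: label_bounds.
- have inj (i i' : 'I_s) (j j' l l' : 'I_(2 * m + 1)) :
      path_adj j l -> path_adj j' l' ->
      label s m i j l = label s m i' j' l' -> [/\ i = i', j = j' & l = l'].
    move=> jl jl' /label_inj[] // Ei Ej El.
    by split; apply: val_inj.
  (* Every edge joins a center to a leaf, which leaves four orientations of two edges. Since [inj]
     takes the position of the center first, edges listed leaf first are flipped. *)
  move=> [[i|] j] [[k|] l] [[i'|] j'] [[k'|] l'] /andP[// _ jl] /andP[// _ jl'] E.
  + rewrite adj_sym in jl; rewrite adj_sym in jl'.
    by have [/= -> /= -> /= ->] := inj _ _ _ _ _ _ jl jl' E.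
  + rewrite adj_sym in jl.
    by have [/= -> /= -> /= ->] := inj _ _ _ _ _ _ jl jl' E; rewrite setUC.
  + rewrite adj_sym in jl'.
    by have [/= -> /= -> /= ->] := inj _ _ _ _ _ _ jl jl' E; rewrite setUC.
  + by have [/= -> /= -> /= ->] := inj _ _ _ _ _ _ jl jl' E.
- move=> k /(label_surj m0)[i [j [l [si jm lm jl <-]]]].
  by exists (None, Ordinal jm), (Some (Ordinal si), Ordinal lm).
- move=> [[i|] j] [[k|] l]; rewrite ?sum_weight_center ?sum_weight_leaf.
  + by move/leaf_sum_inj=> [] // Ei El; congr (Some _, _); apply: val_inj.
  + by move/esym/center_sum_neq_leaf_sum; case.
  + by move/center_sum_neq_leaf_sum; case.
  + by move/center_sum_inj=> Ej; congr (_, _); apply/val_inj/Ej.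
Qed.
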